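(* Let $M$ be a closed surface with a triangulation $\mathcal{T}=\{V,E,F\}$, $V=\{1,\dots,N\}$, let $I:E\to[0,+\infty)$ be an inversive distance, and let $\alpha\in\mathbb{R}$. Let $u(0)\in\ln\Omega$ be arbitrary and let $\{u(t)\mid t\in[0,T)\}$, $0<T\le+\infty$, be the unique maximal solution in $\ln\Omega$ of the $\alpha$-flow $$\frac{du_i}{dt}=s_\alpha r_i^\alpha-K_i,\qquad i\in V,$$ with initial value $u(0)$. If $T<+\infty$, then $u$ can be extended to a solution $\{u(t)\mid t\in[0,+\infty)\}$ in $\mathbb{R}^N$ of the extended $\alpha$-flow $$\frac{du_i}{dt}=s_\alpha r_i^\alpha-\widetilde K_i,\qquad i\in V.$$ That is, for any $u(0)\in\ln\Omega$, the solution to the extended $\alpha$-flow exists for all time $t\in[0,+\infty)$.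
   Context: $V,E,F$ are the vertices, edges and faces of $\mathcal{T}$, $N=|V|$. For $r\in\mathbb{R}^N_{>0}$ each edge $\{ij\}\in E$ gets length $l_{ij}=\sqrt{r_i^2+r_j^2+2r_ir_jI_{ij}}$. $\Omega$ is the set of all $r\in\mathbb{R}^N_{>0}$ such that for every face $\{ijk\}\in F$ the lengths $l_{ij},l_{jk},l_{ik}$ satisfy the three strict triangle inequalities. Coordinates $u_i=\ln r_i$ are used, and $\ln\Omega$ is the image of $\Omega$ under $r\mapsto u$. For $r\in\Omega$, $\theta_i^{jk}$ is the inner angle at vertex $i$ of the Euclidean triangle $\{ijk\}$ with these edge lengths, and $K_i=2\pi-\sum_{\{ijk\}\in F}\theta_i^{jk}$ (sum over the triangles having $i$ as a vertex). For arbitrary $r\in\mathbb{R}^N_{>0}$ the generalized inner angles $\tilde\theta_i^{jk}$ of a face $\{ijk\}$ are: the Euclidean inner angles if the three strict triangle inequalities hold; and if $l_{jk}\ge l_{ij}+l_{ik}$ then $\tilde\theta_i^{jk}=\pi$ and the angles at $j$ and $k$ are $0$ (similarly for the other vertices). The extended curvature is $\widetilde K_i=2\pi-\sum_{\{ijk\}\in F}\tilde\theta_i^{jk}$, defined and continuous on $\mathbb{R}^N_{>0}$. $s_\alpha=2\pi\chi(M)/\|r\|_\alpha^\alpha$ with $\|r\|_\alpha^\alpha=\sum_{i=1}^N r_i^\alpha$. *)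

(* Defs.v *)
From HB Require Import structures.
From mathcomp Require Import all_boot all_order all_algebra.
From mathcomp Require Import all_classical all_reals all_analysis.
Import Order.TTheory GRing.Theory Num.Theory.
Import numFieldNormedType.Exports.

Set Implicit Arguments.
Unset Strict Implicit.
Unset Printing Implicit Defensive.

Local Open Scope ring_scope.

Definition homeomorphic (X Y : topologicalType) (A : set X) (B : set Y) : Prop :=
  exists (f : X -> Y) (g : Y -> X),
    [/\ ({within A, continuous f} /\ {within B, continuous g})%classic,
        forall x, A x -> B (f x),
        forall y, B y -> A (g y),
        forall x, A x -> g (f x) = x
      & forall y, B y -> f (g y) = y].

(* Second countability follows from compactness and the last clause. *)
Definition closed_surface (R : realType) (M : topologicalType) : Prop :=
  [/\ hausdorff_space M,
      compact [set: M]%classic,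
      connected [set: M]%classic,
      exists x : M, True
    & forall x : M, exists (U : set M) (W : set 'rV[R]_2),
        [/\ open U, U x, open W & homeomorphic U W]].

(* The vertices are the elements of 'I_N (so {1, .., N} is shifted to
   {0, .., N-1}), {ij} is [set i; j] and {ijk} is [set i; j; k]. *)
Definition simplicial_data (N : nat) (E F : {set {set 'I_N}}) : Prop :=
  [/\ forall e, e \in E -> #|e| = 2%N,
      forall f, f \in F -> #|f| = 3%N
    & forall f e : {set 'I_N},
        f \in F -> e \subset f -> #|e| = 2%N -> e \in E].

(* Barycentric coordinates. *)
Definition geometric_realization (R : realType) (N : nat)
    (E F : {set {set 'I_N}}) : set 'rV[R]_N :=
  fun x =>
    let supp := [set i | x ord0 i != 0]%SET in
    [/\ forall i, 0 <= x ord0 i,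
        \sum_i x ord0 i = 1
      & [\/ #|supp| = 1%N, supp \in E | supp \in F]].

Definition triangulates (R : realType) (M : topologicalType) (N : nat)
    (E F : {set {set 'I_N}}) : Prop :=
  simplicial_data E F /\
  homeomorphic (@geometric_realization R N E F) [set: M]%classic.

Definition euler_char (N : nat) (E F : {set {set 'I_N}}) : int :=
  N%:Z - #|E|%:Z + #|F|%:Z.

(* I : E -> [0, +oo); the values of I outside E are never used. *)
Definition inversive_distance (R : realType) (N : nat) (E : {set {set 'I_N}})
    (I : {set 'I_N} -> R) : Prop :=
  forall e, e \in E -> 0 <= I e.

Section Curvature.
Context (R : realType) (N : nat) (E F : {set {set 'I_N}}).
Context (I : {set 'I_N} -> R).
Implicit Types (r u : 'rV[R]_N) (i j k : 'I_N).

Definition edge_length r i j : R :=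
  Num.sqrt (r ord0 i ^+ 2 + r ord0 j ^+ 2
            + 2 * r ord0 i * r ord0 j * I [set i; j]%SET).

Definition strict_triangle (a b c : R) : Prop :=
  [/\ a < b + c, b < a + c & c < a + b].

Definition Omega : set 'rV[R]_N := fun r =>
  (forall i, 0 < r ord0 i) /\
  (forall i j k, [set i; j; k]%SET \in F ->
     strict_triangle (edge_length r i j) (edge_length r j k)
                     (edge_length r i k)).

Definition lnOmega : set 'rV[R]_N := (map_mx (@ln R) @` Omega)%classic.

(* Angle opposite to the side a, by the law of cosines. *)
Definition inner_angle (a b c : R) : R :=
  acos ((b ^+ 2 + c ^+ 2 - a ^+ 2) / (2 * b * c)).

Definition gen_inner_angle (a b c : R) : R :=
  if `[< strict_triangle a b c >] then inner_angle a b c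
  else if b + c <= a then pi else 0.

Definition theta r i j k : R :=
  inner_angle (edge_length r j k) (edge_length r i j) (edge_length r i k).

Definition gen_theta r i j k : R :=
  gen_inner_angle (edge_length r j k) (edge_length r i j) (edge_length r i k).

(* The condition j < k makes each face {ijk} at i occur exactly once; i, j, k
   are distinct as soon as all members of F have three elements. *)
Definition curvature r i : R :=
  2 * pi - \sum_(j < N) \sum_(k < N | (j < k)%N && ([set i; j; k]%SET \in F))
             theta r i j k.

Definition ext_curvature r i : R :=
  2 * pi -
  \sum_(j < N) \sum_(k < N | (j < k)%N && ([set i; j; k]%SET \in F)) gen_theta r i j k.

Definition s_alpha (alpha : R) r : R :=
  2 * pi * (euler_char E F)%:~R / \sum_i (r ord0 i `^ alpha).

(* Right-hand sides of the flows, in the coordinates u_i = ln r_i. *)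
Definition alpha_field (alpha : R) u i : R :=
  let r := map_mx (@expR R) u in
  s_alpha alpha r * r ord0 i `^ alpha - curvature r i.

Definition ext_alpha_field (alpha : R) u i : R :=
  let r := map_mx (@expR R) u in
  s_alpha alpha r * r ord0 i `^ alpha - ext_curvature r i.

End Curvature.

Section Flow.
Context (R : realType) (N : nat).
Implicit Types (T : \bar R) (u v : R -> 'rV[R]_N).

Definition time_dom T : set R := fun t => 0 <= t /\ (t%:E < T)%E.

(* Derivative of f relative to A, hence one-sided at an endpoint of A. *)
Definition has_derivative_within (A : set R) (f : R -> R) (t d : R) : Prop :=
  ((fun s => (f s - f t) / (s - t)) @ within A (t^')%classic --> d)%classic.

Definition solution (D : set 'rV[R]_N) (X : 'rV[R]_N -> 'I_N -> R) T u : Prop :=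
  forall t, time_dom T t ->
    D (u t) /\
    forall i, has_derivative_within (time_dom T) (fun s => u s ord0 i) t (X (u t) i).

Definition maximal_solution (D : set 'rV[R]_N) (X : 'rV[R]_N -> 'I_N -> R) T u
    : Prop :=
  solution D X T u /\
  forall T' v, (T < T')%E -> solution D X T' v ->
    ~ (forall t, time_dom T t -> v t = u t).

End Flow.

(* Main.v *)
Require Import Defs.
From HB Require Import structures.
From mathcomp Require Import all_boot all_order all_algebra.
From mathcomp Require Import all_classical all_reals all_analysis.
From mathcomp Require Import ring lra.
Import Order.TTheory GRing.Theory Num.Theory.
Import numFieldNormedType.Exports.
Local Open Scope ring_scope.

(** Why every solution goes on forever.  In the coordinates [u_i = ln r_i] the
    extended right-hand side is a continuous and bounded vector field on all of
    [R^N].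
    - Bounded: [r_i^alpha / sum_j r_j^alpha] lies in [0, 1], and each extended
      angle lies in [0, pi] ([ext_alpha_field_bounded]).
    - Continuous: the cosine rule expression of an angle is at most [-1]
      or at least [1] exactly when a triangle inequality fails, and the extended
      angle is then [pi] or [0] accordingly.  So the extended angle is
      the arc cosine of that expression truncated to [[-1, 1]]
      ([gen_inner_angle_acos_clamp]), and a composite of continuous maps.

    Nothing better than continuity is available at degenerate triangles, so
    global existence rests on Peano's theorem ([peano_global]).  It is obtained
    from piecewise constant Euler approximations with step [1 / (n + 1)].  They
    are bounded at each time, so along a single ultrafilter on the integers
    they converge pointwise at all times at once ([simultaneous_limits]).
    Pointwise convergence suffices: on a short interval around [t] the
    approximations have moved little, hence their increments are nearly the
    length of the interval times the field at the limit point [v t]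
    ([euler_step_drift]).  This estimate passes to the limit and says that [v]
    is differentiable at [t] with the right derivative; no integral and no
    uniform convergence is involved.

    A solution of the flow on [[0, T)] in [ln Omega] solves the extended flow
    ([ext_alpha_field_Omega]).  When [T] is finite the bound on the field makes
    the solution Lipschitz, so it has a limit at [T], and by continuity of the
    field its left derivative there is the value of the field at the limit.  It
    is prolonged by a global solution issued from the limit point
    ([solution_extends]). *)

Set Implicit Arguments.
Unset Strict Implicit.
Unset Printing Implicit Defensive.

(** * Derivatives relative to a set *)

(** Clearing the denominator turns one-sided and two-sided derivatives into the
    same inequality between increments, which is stable under pointwise limits
    and under gluing. *)
Lemma has_derivative_withinP (R : realType) (A : set R) (f : R -> R) (t d : R) :
  has_derivative_within A f t d <->
  forall e, 0 < e -> exists2 eta, 0 < eta &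
    forall s, A s -> `|s - t| < eta -> `|f s - f t - (s - t) * d| <= e * `|s - t|.
Proof.
split=> [/cvgrPdist_le fd e e0|fd].
  have := fd _ e0; rewrite near_withinE near_withinE => /nbhs_ballP[eta /= eta0 fe].
  exists eta => // s As st; have [->|ts] := eqVneq s t.
    by rewrite !subrr mul0r subr0 normr0 mulr0.
  have := fe s; rewrite /ball /= distrC => /(_ st ts As) {}fe.
  have st0 : s - t != 0 by rewrite subr_eq0.
  have -> : f s - f t - (s - t) * d = (s - t) * - (d - (f s - f t) / (s - t)).
    by field.
  by rewrite normrM normrN mulrC ler_wpM2r.
apply/cvgrPdist_le => e e0; have [eta eta0 fe] := fd e e0.
rewrite near_withinE near_withinE; apply/nbhs_ballP; exists eta => //= s.
rewrite /ball /= distrC => st ts As; have st0 : s - t != 0 by rewrite subr_eq0.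
rewrite -(ler_pM2r (_ : 0 < `|s - t|)) ?normr_gt0// -normrM.
have -> : (d - (f s - f t) / (s - t)) * (s - t) = - (f s - f t - (s - t) * d).
  by field.
by rewrite normrN; exact: fe.
Qed.

Lemma has_derivative_within_itv_is_derive (R : realType) (A : set R)
    (f : R -> R) (a b x d : R) :
  (forall s, a <= s <= b -> A s) -> a < x < b ->
  has_derivative_within A f x d -> is_derive x 1 f d.
Proof.
move=> abA /andP[ax xb] /has_derivative_withinP fd.
have fdx : (h^-1 *: ((f \o shift x) (h *: 1) - f x) @[h --> 0^'] --> d)%classic.
  apply/cvgrPdist_le => e e0; have [eta eta0 fe] := fd e e0.
  rewrite near_withinE; apply/nbhs_ballP.
  exists (Num.min eta (Num.min (x - a) (b - x))).
    by rewrite /= !lt_min eta0 !subr_gt0 ax xb.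
  move=> h; rewrite /ball /= sub0r normrN !lt_min => /and3P[he hxa hbx] h0.
  have {}fe : `|f (h + x) - f x - h * d| <= e * `|h|.
    rewrite -[X in _ - _ - X * d](addrK x) -[X in e * `|X|](addrK x).
    apply: fe; last by rewrite addrK.
    by apply: abA; move: hxa hbx; rewrite !ltr_norml; lra.
  rewrite /GRing.scale /= mulr1 -(ler_pM2r (_ : 0 < `|h|)) ?normr_gt0// -normrM.
  have -> : (d - h^-1 * (f (h + x) - f x)) * h = - (f (h + x) - f x - h * d).
    by field.
  by rewrite normrN.
by split; [apply/cvg_ex; exists d|apply/cvg_lim].
Qed.

Lemma has_derivative_within_continuous (R : realType) (A : set R)
    (f : R -> R) (a b : R) (d : R -> R) :
  (forall s, a <= s <= b -> A s) ->
  (forall s, a <= s <= b -> has_derivative_within A f s (d s)) ->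
  {within `[a, b], continuous f}%classic.
Proof.
move=> abA fd; apply/subspace_continuousP => x; rewrite /= in_itv /= => xab.
apply/cvgrPdist_le => e e0; have /has_derivative_withinP fx := fd x xab.
have [eta eta0 {}fx] := fx 1 ltr01.
have D0 : 0 < 1 + `|d x| by rewrite ltr_wpDr.
rewrite near_withinE; apply/nbhs_ballP.
exists (Num.min eta (e / (1 + `|d x|))); first by rewrite /= lt_min eta0 divr_gt0.
move=> s; rewrite /ball /= distrC lt_min => /andP[se sd].
rewrite in_itv /= => sab; rewrite distrC.
have -> : f s - f x = (f s - f x - (s - x) * d x) + (s - x) * d x by ring.
apply: le_trans (ler_normD _ _) _.
have := fx s (abA s sab) se; rewrite mul1r normrM => fsx.
move: sd; rewrite ltr_pdivlMr // mulrDr mulr1 => sd.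
by apply/ltW/(le_lt_trans _ sd); rewrite lerD2r.
Qed.

(** Control of [d s - c] rather than of [d s] alone serves twice: with [c = 0]
    it yields the Lipschitz bound, with [c] the value of the field at a point it
    yields the derivative at the end of the interval. *)
Lemma mean_value_inequality (R : realType) (A : set R) (f d : R -> R)
    (c e a b : R) :
  a <= b ->
  (forall s, a <= s <= b ->
     [/\ A s, has_derivative_within A f s (d s) & `|d s - c| <= e]) ->
  `|f b - f a - (b - a) * c| <= e * (b - a).
Proof.
move=> ab fd.
have abA s : a <= s <= b -> A s by case/fd.
have fd' s : a <= s <= b -> has_derivative_within A f s (d s) by case/fd.
have fder x : x \in `]a, b[ -> is_derive x 1 f (d x).
  rewrite in_itv /= => xab.
  apply: (has_derivative_within_itv_is_derive abA xab (fd' _ _)).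
  by case/andP: xab => *; rewrite !ltW.
have [x xab ->] := MVT_segment ab fder (has_derivative_within_continuous abA fd').
have -> : d x * (b - a) - (b - a) * c = (d x - c) * (b - a) by ring.
rewrite normrM (ger0_norm (_ : 0 <= b - a)) ?subr_ge0 // ler_wpM2r ?subr_ge0 //.
by have [] := fd x xab.
Qed.

(** * Limits along ultrafilters *)

Lemma lim_dist_le (R : realType) (S : Type) (U : set_system S)
    {PU : ProperFilter U} (f : S -> R) (l c B : R) :
  (f @ U --> l)%classic ->
  (forall e, 0 < e -> \forall s \near U, `|f s - c| <= B + e) ->
  `|l - c| <= B.
Proof.
move=> fl fB; apply/ler_addgt0Pr => e e0.
apply: cvgr_to_le (fB e e0); apply: cvg_norm.
by apply: cvgB fl _; exact: cvg_cst.
Qed.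

Lemma fmap_ultra (S T : Type) (f : S -> T) (U : set_system S) :
  UltraFilter U -> UltraFilter (f @ U)%classic.
Proof.
move=> UU; split=> [|G PG fUG]; first exact: fmap_proper_filter.
apply/seteqP; split=> // A GA.
have [//|UA] := in_ultra_setVsetC (f @^-1` A)%classic UU.
have GA' : G (~` A)%classic by apply: fUG.
by have [x []] := filter_ex (filterI GA GA').
Qed.

(** Compactness of closed intervals turned into a simultaneous selection: along
    one ultrafilter, all the functions of a bounded family of any size
    converge. *)
Lemma simultaneous_limits (R : realType) (S K : Type) (G : set_system S)
    {PG : ProperFilter G} (f : K -> S -> R) (B : K -> R) :
  (forall k, \forall s \near G, `|f k s| <= B k) ->
  exists U : set_system S, exists l : K -> R,
    [/\ ProperFilter U, (G `<=` U)%classic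
      & forall k, (f k @ U --> l k)%classic].
Proof.
move=> fB; have [U [UU GU]] := ultraFilterLemma PG.
have lim k : exists l : R, (f k @ U --> l)%classic.
  have fU : (f k @ U)%classic `[- B k, B k]%classic.
    by apply: GU; apply: filterS (fB k) => s; rewrite /= in_itv /= -ler_norml.
  have := @segment_compact R (- B k) (B k); rewrite compact_ultra /=.
  by move=> /(_ _ (fmap_ultra (f k) UU) fU) [l [_ fl]]; exists l.
have [l fl] := choice lim.
exists U, l; split=> //; exact: ultra_proper.
Qed.

(** * Continuous bounded vector fields *)

Section BoundedField.
Context (R : realType) (N : nat).
Implicit Types (X : 'rV[R]_N -> 'I_N -> R) (y z u w : 'rV[R]_N).

Lemma continuous_rV_modulus (g : 'rV[R]_N -> R) y e :
  {for y, continuous g}%classic -> 0 < e ->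
  exists2 d, 0 < d &
    forall z, (forall j, `|z ord0 j - y ord0 j| <= d) -> `|g z - g y| <= e.
Proof.
move=> /cvgrPdist_le gy e0; have /nbhs_ballP[d /= d0 yd] := gy e e0.
have d20 : 0 < d / 2 by rewrite divr_gt0.
exists (d / 2) => // z zy; rewrite distrC; apply: yd; split=> // i j.
rewrite (ord1 i) /ball /= distrC; apply: le_lt_trans (zy j) _.
by rewrite ltr_pdivrMr // ltr_pMr // ltr1n.
Qed.

Definition euler_iter X u (h : R) (k : nat) : 'rV[R]_N :=
  iter k (fun y => y + h *: \row_i X y i) u.

(** The polygon vertices are held constant between grid points: the jumps, of
    size [O(h)], vanish in the limit. *)
Definition euler_step X u (h t : R) : 'rV[R]_N :=
  euler_iter X u h (Num.trunc (t / h)).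

(** Between the grid points below [a] and [b] the vertices advance by
    [h * X] per step.  The number of steps times [h] differs from [b - a] by at
    most [h], which accounts for both error terms. *)
Lemma euler_step_drift X u (h a b : R) i (c e : R) :
  0 < h -> 0 <= a <= b ->
  (forall t, a <= t <= b -> `|X (euler_step X u h t) i - c| <= e) ->
  `|euler_step X u h b ord0 i - euler_step X u h a ord0 i - (b - a) * c|
    <= e * (b - a + h) + h * `|c|.
Proof.
move=> h0 /andP[a0 ab] Xc.
have e0 : 0 <= e by apply: le_trans (normr_ge0 _) (Xc a _); rewrite lexx.
rewrite /euler_step; set x := euler_iter X u h.
set m := Num.trunc (a / h); set p := Num.trunc (b / h).
have b0 : 0 <= b by exact: le_trans ab.
have /andP[ma am] : m%:R * h <= a < m.+1%:R * h.
  by rewrite -ler_pdivlMr // -ltr_pdivrMr // truncn_itv // divr_ge0 // ltW.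
have /andP[pb bp] : p%:R * h <= b < p.+1%:R * h.
  by rewrite -ler_pdivlMr // -ltr_pdivrMr // truncn_itv // divr_ge0 // ltW.
have mp : (m <= p)%N by rewrite le_truncn // ler_pM2r ?invr_gt0.
have Xk k : (m <= k <= p)%N -> `|X (x k) i - c| <= e.
  case/andP=> mk kp; move: mk; rewrite leq_eqVlt => /predU1P[<-|mk].
    by apply: Xc; rewrite lexx.
  have := Xc (k%:R * h); rewrite /euler_step mulfK ?gt_eqF // natrK; apply.
  apply/andP; split.
    by apply: ltW (lt_le_trans am _); rewrite ler_pM2r // ler_nat.
  by apply: le_trans pb; rewrite ler_pM2r // ler_nat.
have drift k : (m + k <= p)%N ->
    `|x (m + k)%N ord0 i - x m ord0 i - k%:R * h * c| <= e * (k%:R * h).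
  elim: k => [|k IHk] mkp.
    by rewrite addn0 subrr !mul0r subr0 normr0 mulr0.
  rewrite addnS in mkp; have {}IHk := IHk (ltnW mkp).
  have := Xk (m + k)%N; rewrite leq_addr ltnW // => /(_ isT) Xmk.
  have -> : x (m + k.+1)%N ord0 i = x (m + k)%N ord0 i + h * X (x (m + k)%N) i.
    by rewrite addnS /x /= !mxE.
  rewrite -natr1.
  have -> : x (m + k)%N ord0 i + h * X (x (m + k)%N) i - x m ord0 i
      - (k%:R + 1) * h * c
    = (x (m + k)%N ord0 i - x m ord0 i - k%:R * h * c)
      + h * (X (x (m + k)%N) i - c) by ring.
  apply: le_trans (ler_normD _ _) _.
  have -> : e * ((k%:R + 1) * h) = e * (k%:R * h) + h * e by ring.
  by rewrite lerD // normrM gtr0_norm // ler_pM2l.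
have := drift (p - m)%N; rewrite subnKC // leqnn natrB // => /(_ isT) {}drift.
have -> : x p ord0 i - x m ord0 i - (b - a) * c =
    (x p ord0 i - x m ord0 i - (p%:R - m%:R) * h * c)
    + ((p%:R - m%:R) * h - (b - a)) * c by ring.
apply: le_trans (ler_normD _ _) _; rewrite -natr1 in am; rewrite -natr1 in bp.
rewrite normrM lerD //.
  by apply: le_trans drift _; rewrite ler_wpM2l //; lra.
by rewrite ler_wpM2r // ler_norml; apply/andP; split; lra.
Qed.

Lemma euler_step0 X u h : euler_step X u h 0 = u.
Proof. by rewrite /euler_step mul0r truncn0. Qed.

Lemma euler_step_lipschitz X u (B h a b : R) i :
  (forall y j, `|X y j| <= B) -> 0 < h -> 0 <= a <= b ->
  `|euler_step X u h b ord0 i - euler_step X u h a ord0 i| <= B * (b - a + h).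
Proof.
move=> XB h0 ab; have := @euler_step_drift X u h a b i 0 B h0 ab.
rewrite mulr0 subr0 normr0 mulr0 addr0; apply=> t _.
by rewrite subr0.
Qed.

Context (X : 'rV[R]_N -> 'I_N -> R) (B : R).
Hypothesis X_continuous : forall i, continuous (X^~ i).
Hypothesis X_bounded : forall y i, `|X y i| <= B.

(** The field is read off at the single point [v t], so its continuity there,
    together with convergence of the approximations at time [t] and their
    approximate Lipschitz bound, controls all increments near [t]. *)
Lemma peano_global u :
  exists v : R -> 'rV[R]_N, v 0 = u /\ solution [set: 'rV[R]_N]%classic X +oo%E v.
Proof.
pose h n : R := n.+1%:R^-1.
have h0 n : 0 < h n by rewrite invr_gt0 ltr0n.
pose x n t i := euler_step X u (h n) t ord0 i.
(* The absolute value makes the bound hold at every real time. *)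
have [k|U [l [PU oU xl]]] := @simultaneous_limits R nat (R * 'I_N)%type \oo%classic _
    (fun k n => x n `|k.1| k.2) (fun k => `|u ord0 k.2| + B * (`|k.1| + 1)).
  apply: nearW => n; case: k => t i /=.
  have B0 : 0 <= B by apply: le_trans (X_bounded u i).
  have := @euler_step_lipschitz X u B (h n) 0 `|t| i X_bounded (h0 n).
  rewrite lexx normr_ge0 euler_step0 subr0 -/(x n _ _) => /(_ isT) xu.
  rewrite -[x n _ _](subrK (u ord0 i)) addrC.
  apply: le_trans (ler_normD _ _) _; rewrite lerD2l; apply: le_trans xu _.
  by rewrite ler_wpM2l // lerD2l invf_le1 ?ltr0n // ler1n.
pose v t : 'rV[R]_N := \row_i l (t, i).
have xv t i : 0 <= t -> (x n t i @[n --> U] --> v t ord0 i)%classic.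
  by move=> t0; rewrite mxE; have := xl (t, i); rewrite /= ger0_norm.
have hU e : 0 < e -> \forall n \near U, h n <= e.
  move=> e0; apply: oU; near=> n; apply: ltW; near: n.
  exact: (near_infty_natSinv_lt (PosNum e0)).
have v_drift t i e : 0 <= t -> 0 < e -> exists2 eta, 0 < eta &
    forall a b, 0 <= a <= b -> `|a - t| < eta -> `|b - t| < eta ->
    `|v b ord0 i - v a ord0 i - (b - a) * X (v t) i| <= e * (b - a).
  move=> t0 e0; have B0 : 0 <= B by apply: le_trans (X_bounded u i).
  have [d d0 Xd] := continuous_rV_modulus (@X_continuous i (v t)) e0.
  (* Over times within [eta] of [t], a motion at speed [B] plus one Euler step
     stays within [d / 2]; the other [d / 2] is for the distance of the
     approximation from its limit at time [t]. *)
  pose eta := d / (4 * (B + 1)).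
  have B1 : 0 < 4 * (B + 1) by lra.
  have eta0 : 0 < eta by rewrite divr_gt0.
  have Beta : B * (eta + eta) <= d / 2.
    have : eta * (4 * (B + 1)) = d by rewrite divfK // gt_eqF.
    lra.
  exists eta => // a b /[dup] ab /andP[a0 ab'] at_ bt.
  apply: (@lim_dist_le _ _ U _ (fun n => x n b i - x n a i)).
    by apply: cvgB; apply: xv => //; exact: le_trans ab'.
  move=> e' e'0; set c := X (v t) i.
  have ec : 0 < e + `|c| by rewrite ltr_wpDr.
  have hsmall := hU _ (divr_gt0 e'0 ec); have heta := hU _ eta0.
  have xt : \forall n \near U, forall j, `|v t ord0 j - x n t j| <= d / 2.
    apply: filter_forall => j; have /cvgrPdist_le := xv t j t0; apply.
    by rewrite divr_gt0.
  near=> n; apply: le_trans (@euler_step_drift _ _ _ _ _ _ _ e (h0 n) ab _) _; last first.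
    have hn : h n <= e' / (e + `|c|) by near: n.
    rewrite -/c mulrDr -addrA lerD2l (mulrC e) -mulrDr.
    by rewrite -ler_pdivlMr.
  move=> s /andP[sa sb]; apply: Xd => j; rewrite -/(x n s j).
  have hn : h n <= eta by near: n.
  have xvt : `|v t ord0 j - x n t j| <= d / 2.
    by move: (j); near: n.
  rewrite distrC in xvt.
  have -> : x n s j - v t ord0 j = x n s j - x n t j + (x n t j - v t ord0 j).
    by ring.
  apply: le_trans (ler_normD _ _) _.
  suff : `|x n s j - x n t j| <= B * (eta + eta) by lra.
  have [st|ts] := leP s t.
    rewrite distrC; apply: le_trans (@euler_step_lipschitz _ _ _ _ _ _ _ X_bounded (h0 n) _) _.
      by rewrite st andbT; exact: le_trans sa.
    by rewrite ler_wpM2l // lerD //; move: at_; rewrite ltr_norml; lra.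
  apply: le_trans (@euler_step_lipschitz _ _ _ _ _ _ _ X_bounded (h0 n) _) _.
    by rewrite t0 ltW.
  by rewrite ler_wpM2l // lerD //; move: bt; rewrite ltr_norml; lra.
exists v; split.
  apply/rowP => i.
  have xu : (x n 0 i @[n --> U] --> u ord0 i)%classic.
    have -> : (fun n => x n 0 i) = cst (u ord0 i).
      by apply/funext => n; rewrite /x euler_step0.
    exact: cvg_cst.
  by apply: (cvg_unique _ (xv 0 i (lexx 0)) xu); exact: norm_hausdorff.
move=> t [t0 _]; split=> // i; apply/has_derivative_withinP => e e0.
have [eta eta0 vt] := v_drift t i e t0 e0; exists eta => // s [s0 _] st.
have tt : `|t - t| < eta by rewrite subrr normr0.
have [ts|st'] := leP t s.
  by rewrite (ger0_norm (_ : 0 <= s - t)) ?subr_ge0 //; apply: vt; rewrite ?t0.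
rewrite distrC in st *; rewrite (gtr0_norm (_ : 0 < t - s)) ?subr_gt0 //.
have -> : v s ord0 i - v t ord0 i - (s - t) * X (v t) i =
  - (v t ord0 i - v s ord0 i - (t - s) * X (v t) i) by ring.
by rewrite normrN; apply: vt; rewrite ?s0 ?ltW // distrC.
Unshelve. all: by end_near. Qed.

(** The limit at [T] is taken along an ultrafilter finer than the left
    neighbourhoods of [T]; the Lipschitz bound, passed to this limit, gives back
    convergence as [t] tends to [T]. *)
Lemma solution_extends (T : R) (u : R -> 'rV[R]_N) :
  0 < T -> solution [set: 'rV[R]_N]%classic X T%:E u ->
  exists v : R -> 'rV[R]_N,
    (forall t, time_dom T%:E t -> v t = u t) /\
    solution [set: 'rV[R]_N]%classic X +oo%E v.
Proof.
move=> T0 usol.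
have dom t : 0 <= t -> t < T -> time_dom T%:E t by move=> *; split.
have u_drift a b i c e : 0 <= a <= b -> b < T ->
    (forall t, a <= t <= b -> `|X (u t) i - c| <= e) ->
    `|u b ord0 i - u a ord0 i - (b - a) * c| <= e * (b - a).
  move=> /andP[a0 ab] bT Xc.
  apply: (@mean_value_inequality R (time_dom T%:E) (fun t => u t ord0 i)
           (fun t => X (u t) i)) => // s /andP[as_ sb].
  have sT : time_dom T%:E s.
    by apply: dom; [exact: le_trans as_|exact: le_lt_trans bT].
  by split=> //; [have [_] := usol s sT; apply|apply: Xc; rewrite as_].
have u_lip a b i : 0 <= a <= b -> b < T ->
    `|u b ord0 i - u a ord0 i| <= B * (b - a).
  move=> ab bT; have := @u_drift a b i 0 B ab bT.
  by rewrite mulr0 subr0; apply=> t _; rewrite subr0.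
have near_T a : a < T -> \forall t \near T^'-%classic, a < t < T.
  move=> aT; near=> t; apply/andP; split; near: t.
    exact: nbhs_left_gt.
  exact: nbhs_left_lt.
have [i|U [uT [PU TU ul]]] := @simultaneous_limits R R 'I_N T^'-%classic _
    (fun i t => u t ord0 i) (fun i => `|u 0 ord0 i| + B * T).
  have B0 : 0 <= B by apply: le_trans (X_bounded 0 i).
  apply: filterS (near_T 0 T0) => t /andP[t0 tT].
  rewrite -[u t ord0 i](subrK (u 0 ord0 i)) addrC.
  apply: le_trans (ler_normD _ _) _; rewrite lerD2l.
  apply: le_trans (u_lip 0 t i _ tT) _; first by rewrite lexx ltW.
  by rewrite subr0 ler_wpM2l // ltW.
pose z : 'rV[R]_N := \row_i uT i.
have uz_drift a i c e : 0 <= a < T ->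
    (forall t, a <= t < T -> `|X (u t) i - c| <= e) ->
    `|z ord0 i - u a ord0 i - (T - a) * c| <= e * (T - a).
  move=> /andP[a0 aT] Xc.
  have e0 : 0 <= e by apply: le_trans (normr_ge0 _) (Xc a _); rewrite lexx.
  rewrite -addrA -opprD mxE.
  apply: (lim_dist_le (ul i)) => e' e'0.
  (* Stopping at [t] instead of [T] costs at most [(T - t) * |c|]. *)
  have Ta : T - e' / (e + `|c| + 1) < T
    by rewrite ltrBlDr ltrDl divr_gt0 // ltr_wpDl // addr_ge0.
  apply: TU; move: (near_T a aT) (near_T _ Ta).
  apply: filterS2 => t /andP[at_ tT] /andP[te _].
  have a0t : 0 <= a <= t by rewrite a0 ltW.
  have ut : `|u t ord0 i - u a ord0 i - (t - a) * c| <= e * (t - a).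
    apply: u_drift => // s /andP[as_ st].
    by apply: Xc; rewrite as_ (le_lt_trans st).
  have -> : u t ord0 i - (u a ord0 i + (T - a) * c) =
    (u t ord0 i - u a ord0 i - (t - a) * c) + (t - T) * c by ring.
  apply: le_trans (ler_normD _ _) _.
  have : `|(t - T) * c| <= e'.
    rewrite normrM distrC (gtr0_norm (_ : 0 < T - t)) ?subr_gt0 //.
    have ec1 : 0 < e + `|c| + 1 by rewrite ltr_wpDl // addr_ge0.
    apply: (@le_trans _ _ ((T - t) * (e + `|c| + 1))).
      by rewrite ler_pM2l ?subr_gt0 // -addrA addrCA lerDl addr_ge0.
    by rewrite -ler_pdivlMr //; move: te; lra.
  have : e * (t - a) <= e * (T - a) by rewrite ler_wpM2l // lerD2r ltW.
  by lra.
have uz_lip a i : 0 <= a < T -> `|z ord0 i - u a ord0 i| <= B * (T - a).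
  move=> aT; have := @uz_drift a i 0 B aT.
  by rewrite mulr0 subr0; apply=> t _; rewrite subr0.
have [w [w0 wsol]] := peano_global z.
pose v t := if t < T then u t else w (t - T).
have vu t : t < T -> v t = u t by rewrite /v => ->.
have vw t : T <= t -> v t = w (t - T) by rewrite /v leNgt => /negbTE ->.
exists v; split; first by move=> t [_]; rewrite lte_fin; exact: vu.
move=> t [t0 _]; split=> // i; apply/has_derivative_withinP => e e0.
have [tT|Tt] := ltP t T.
  have [_ /(_ i)/has_derivative_withinP/(_ _ e0)[eta eta0 ud]] := usol t (dom t t0 tT).
  exists (Num.min eta (T - t)); first by rewrite lt_min eta0 subr_gt0.
  move=> s [s0 _]; rewrite lt_min => /andP[st sT].
  have {}sT : s < T by move: sT; rewrite ltr_norml; lra.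
  by rewrite !vu //; apply: ud => //; exact: dom.
have [_ /(_ i)/has_derivative_withinP/(_ _ e0)[eta eta0 wd]] :
    [set: 'rV[R]_N]%classic (w (t - T)) /\ forall i : 'I_N,
      has_derivative_within (time_dom +oo%E) (fun s : R => w s ord0 i) (t - T) (X (w (t - T)) i).
  by apply: wsol; split; rewrite ?ltry // subr_ge0.
have right s : T <= s -> `|s - t| < eta ->
    `|v s ord0 i - v t ord0 i - (s - t) * X (v t) i| <= e * `|s - t|.
  move=> Ts; rewrite !vw // => st.
  have <- : s - T - (t - T) = s - t by ring.
  apply: wd; first by split; rewrite ?ltry // subr_ge0.
  by have -> : s - T - (t - T) = s - t by ring.
(* The remaining difficulty is the gluing time [t = T]. *)
move: Tt; rewrite le_eqVlt => /predU1P[Tt|Tt]; last first.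
  exists (Num.min eta (t - T)); first by rewrite lt_min eta0 subr_gt0.
  move=> s [s0 _]; rewrite lt_min => /andP[st sT].
  by apply: right => //; move: sT; rewrite ltr_norml; lra.
have vz : v t = z by rewrite vw -Tt ?lexx // subrr w0.
have B0 : 0 <= B by apply: le_trans (X_bounded z i).
have [d d0 Xd] := continuous_rV_modulus (@X_continuous i z) e0.
have B1 : 0 < B + 1 by lra.
exists (Num.min eta (d / (B + 1))); first by rewrite lt_min eta0 divr_gt0.
move=> s [s0 _]; rewrite lt_min => /andP[st sd].
have [Ts|sT] := leP T s; first exact: right.
rewrite vz (vu s) // -Tt in st sd *.
rewrite distrC in st sd *; rewrite (gtr0_norm (_ : 0 < T - s)) ?subr_gt0 // in sd *.
have -> : u s ord0 i - z ord0 i - (s - T) * X z i =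
  - (z ord0 i - u s ord0 i - (T - s) * X z i) by ring.
rewrite normrN; apply: uz_drift; first by rewrite s0.
move=> r /andP[sr rT]; apply: Xd => j; rewrite distrC.
apply: le_trans (uz_lip _ _ _) _; first by rewrite rT andbT; exact: le_trans sr.
apply: (@le_trans _ _ ((T - s) * (B + 1))).
  have : B * (T - r) <= B * (T - s) by rewrite ler_wpM2l // lerD2l lerN2.
  by move: sT; lra.
by rewrite -ler_pdivlMr // ltW.
Unshelve. all: by end_near. Qed.

End BoundedField.

(** * The extended flow field *)

Section ExtendedField.
Context (R : realType).

(** At the endpoints of [[-1, 1]] continuity comes from [acos] being the inverse
    of an injective continuous function on a compact interval. *)
Lemma continuous_acos_clamp :
  continuous (fun x : R => acos (Num.max (- 1) (Num.min 1 x))).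
Proof.
have acosc : {within `[(-1 : R), 1], continuous (@acos R)}%classic.
  rewrite -[X in `[X, _]]cospi -[X in `[_, X]]cos0.
  apply: segment_can_ge_continuous; first exact: pi_ge0.
    by apply: continuous_subspaceT; exact: continuous_cos.
  exact: cosK.
pose clamp (x : R) := Num.max (- 1) (Num.min 1 x).
have clamp_itv x : `[(-1 : R), 1]%classic (clamp x).
  rewrite /= in_itv /= /clamp le_max lexx /= ge_max ge_min lexx /= andbT.
  by lra.
move=> x; rewrite -/(clamp x).
have /subspace_continuousP/(_ _ (clamp_itv x)) acosx := acosc.
have clampc : {for x, continuous clamp}.
  apply: (@continuous_max R _ (cst (-1)) (fun y : R^o => Num.min 1 y)).
    exact: cvg_cst.
  by apply: (@continuous_min R _ (cst 1) id); [exact: cvg_cst|exact: cvg_id].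
move=> A nA; have xA := clampc _ (acosx A nA).
by apply: (@filterS _ _ (nbhs_filter x) _ _ _ xA) => y; apply; exact: clamp_itv.
Qed.

(** The quotient plus or minus one is [((b + c)^2 - a^2) / (2 b c)] and
    [((b - c)^2 - a^2) / (2 b c)], whose signs are decided by the triangle
    inequalities. *)
Lemma gen_inner_angle_acos_clamp (a b c : R) : 0 < a -> 0 < b -> 0 < c ->
  gen_inner_angle a b c =
  acos (Num.max (- 1) (Num.min 1 ((b ^+ 2 + c ^+ 2 - a ^+ 2) / (2 * b * c)))).
Proof.
move=> a0 b0 c0; rewrite /gen_inner_angle.
have bc0 : 0 < 2 * b * c by rewrite !mulr_gt0.
case: asboolP => [[abc bac cab]|nabc].
  rewrite /inner_angle min_r ?max_r //.
    by rewrite ler_pdivlMr //; nra.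
  by rewrite ler_pdivrMr //; nra.
case: ifPn => [bca|]; last rewrite -ltNge => abc.
  rewrite -acosN1 max_l // ge_min ler_pdivrMr //; apply/orP; right; nra.
have -> : Num.min 1 ((b ^+ 2 + c ^+ 2 - a ^+ 2) / (2 * b * c)) = 1.
  apply: min_l; rewrite ler_pdivlMr // mul1r.
  have [bac|bac] := ltP b (a + c); last by nra.
  have [cab|cab] := ltP c (a + b); last by nra.
  by case: nabc.
by rewrite max_r ?acos1 //; lra.
Qed.

Lemma gen_inner_angle_itv (a b c : R) : 0 < a -> 0 < b -> 0 < c ->
  0 <= gen_inner_angle a b c <= pi.
Proof.
move=> a0 b0 c0; rewrite gen_inner_angle_acos_clamp //; set x := Num.max _ _.
have x1 : -1 <= x <= 1.
  by rewrite le_max lexx /= ge_max ge_min lexx /= andbT; lra.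
by rewrite acos_ge0 // acos_lepi.
Qed.

Context (N : nat) (E F : {set {set 'I_N}}) (I : {set 'I_N} -> R).
Hypothesis EF : simplicial_data E F.
Hypothesis I_ge0 : inversive_distance E I.

Local Notation radii := (map_mx (@expR R)).

Lemma face_edges i j k : [set i; j; k]%SET \in F ->
  [/\ [set i; j]%SET \in E, [set j; k]%SET \in E & [set i; k]%SET \in E].
Proof.
case: EF => _ F3 FE ijkF.
have [ij jk ik] : [/\ i != j, j != k & i != k].
  have := F3 _ ijkF; rewrite finset.setUC cardsU1 !inE cards2.
  by rewrite ![k == _]eq_sym; do 3 case: eqP.
split; apply: (FE _ _ ijkF); rewrite ?cards2 ?ij ?jk ?ik //;
  by apply/fintype.subsetP => x; rewrite !inE => /orP[] ->; rewrite ?orbT.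
Qed.

Lemma edge_length_gt0 (u : 'rV[R]_N) i j : [set i; j]%SET \in E ->
  0 < edge_length I (radii u) i j.
Proof.
move=> /I_ge0 I0; rewrite sqrtr_gt0 !mxE.
rewrite ltr_pwDl ?ltr_pwDl ?exprn_gt0 ?expR_gt0 // ?sqr_ge0 //.
by rewrite !mulr_ge0 // expR_ge0.
Qed.

Lemma radius_continuous i : continuous (fun u : 'rV[R]_N => radii u ord0 i).
Proof.
have -> : (fun u : 'rV[R]_N => radii u ord0 i) = @expR R \o (fun u => u ord0 i).
  by apply/funext => u; rewrite mxE.
move=> u; apply: (@continuous_comp _ _ _ (fun v : 'rV[R]_N => v ord0 i)).
  exact: coord_continuous.
exact: continuous_expR.
Qed.

Lemma edge_length_continuous i j :
  continuous (fun u : 'rV[R]_N => edge_length I (radii u) i j).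
Proof.
move=> u; have ri := @radius_continuous i u; have rj := @radius_continuous j u.
apply: continuous_comp; last exact: sqrt_continuous.
exact: (cvgD (cvgD (cvgM ri ri) (cvgM rj rj))
             (cvgM (cvgM (cvgM (cvg_cst _) ri) rj) (cvg_cst _))).
Qed.

(** The angle is only described by the truncated arc cosine when the three
    lengths are positive; this is where the nonnegativity of the inversive
    distance on the edges of the face enters. *)
Lemma gen_theta_continuous i j k : [set i; j; k]%SET \in F ->
  continuous (fun u : 'rV[R]_N => gen_theta I (radii u) i j k).
Proof.
move=> /face_edges[ij jk ik].
pose l i j (u : 'rV[R]_N) := edge_length I (radii u) i j.
have -> : (fun u : 'rV[R]_N => gen_theta I (radii u) i j k) =
  (fun x => acos (Num.max (- 1) (Num.min 1 x))) \o
  (fun u => (l i j u ^+ 2 + l i k u ^+ 2 - l j k u ^+ 2) / (2 * l i j u * l i k u)).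
  apply/funext => u; rewrite /gen_theta gen_inner_angle_acos_clamp //;
    exact: edge_length_gt0.
move=> u; apply: continuous_comp; last exact: continuous_acos_clamp.
have lc a b : (l a b v @[v --> u] --> l a b u)%classic by exact: edge_length_continuous.
have l2 a b : (l a b v ^+ 2 @[v --> u] --> l a b u ^+ 2)%classic.
  exact: (cvgM (lc a b) (lc a b)).
have denom0 : 2 * l i j u * l i k u != 0.
  by rewrite !mulf_neq0 // gt_eqF // edge_length_gt0.
exact: (cvgM (cvgB (cvgD (l2 _ _) (l2 _ _)) (l2 _ _))
             (cvgV denom0 (cvgM (cvgM (cvg_cst _) (lc _ _)) (lc _ _)))).
Qed.

Lemma gen_theta_itv (u : 'rV[R]_N) i j k : [set i; j; k]%SET \in F ->
  0 <= gen_theta I (radii u) i j k <= pi.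
Proof.
move=> /face_edges[ij jk ik].
by apply: gen_inner_angle_itv; exact: edge_length_gt0.
Qed.

Lemma ext_curvature_continuous i :
  continuous (fun u : 'rV[R]_N => ext_curvature F I (radii u) i).
Proof.
move=> u; have angles : {for u, continuous (fun v : 'rV[R]_N =>
    \sum_(j < N) \sum_(k < N | (j < k)%N && ([set i; j; k]%SET \in F))
      gen_theta I (radii v) i j k)}.
  apply: (continuous_big add_continuous) => j _.
  apply: (continuous_big add_continuous) => k /andP[_].
  exact: gen_theta_continuous.
exact: (cvgB (cvg_cst _) angles).
Qed.

Lemma ext_curvature_bounded (u : 'rV[R]_N) i :
  `|ext_curvature F I (radii u) i| <= 2 * pi + pi *+ N *+ N.
Proof.
have pi0 := pi_ge0 R.
apply: le_trans (ler_normB _ _) _.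
rewrite (ger0_norm (_ : 0 <= 2 * pi)) ?mulr_ge0 // lerD2l.
rewrite -[in leRHS](card_ord N) -!sumr_const.
apply: le_trans (ler_norm_sum _ _ _) _; apply: ler_sum => j _.
apply: le_trans (ler_norm_sum _ _ _) _; rewrite big_mkcond /=.
apply: ler_sum => k _; case: ifP => // /andP[_ ijk].
by have /andP[t0 tpi] := gen_theta_itv u ijk; rewrite ger0_norm.
Qed.

Lemma radius_powR (alpha : R) (u : 'rV[R]_N) i :
  radii u ord0 i `^ alpha = expR (u ord0 i * alpha).
Proof. by rewrite mxE expRM. Qed.

Lemma sum_radius_powR_gt0 (alpha : R) (u : 'rV[R]_N) (i : 'I_N) :
  0 < \sum_j radii u ord0 j `^ alpha.
Proof.
rewrite (bigD1 i) //= ltr_pwDl ?radius_powR ?expR_gt0 //.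
by apply: sumr_ge0 => j _; rewrite radius_powR expR_ge0.
Qed.

Lemma ext_alpha_field_continuous alpha i :
  continuous (fun u : 'rV[R]_N => ext_alpha_field E F I alpha u i).
Proof.
have powc j : continuous (fun u : 'rV[R]_N => radii u ord0 j `^ alpha).
  under eq_fun do rewrite radius_powR.
  move=> u; apply: (@continuous_comp _ _ _ (fun v : 'rV[R]_N => v ord0 j * alpha)).
    exact: (cvgM (@coord_continuous _ _ _ ord0 j u) (cvg_cst _)).
  exact: continuous_expR.
move=> u; have S0 : \sum_j radii u ord0 j `^ alpha != 0.
  by rewrite gt_eqF // sum_radius_powR_gt0.
have sumc : {for u, continuous (fun v : 'rV[R]_N => \sum_j radii v ord0 j `^ alpha)}.
  by apply: (continuous_big add_continuous) => j _; exact: powc.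
exact: (cvgB (cvgM (cvgM (cvg_cst _) (cvgV S0 sumc)) (powc i u))
             (@ext_curvature_continuous i u)).
Qed.

Lemma ext_alpha_field_bounded alpha (u : 'rV[R]_N) i :
  `|ext_alpha_field E F I alpha u i| <=
  `|2 * pi * (euler_char E F)%:~R| + (2 * pi + pi *+ N *+ N).
Proof.
apply: le_trans (ler_normB _ _) _; rewrite lerD ?ext_curvature_bounded //.
have S0 := sum_radius_powR_gt0 alpha u i.
rewrite /s_alpha -mulrA normrM ler_piMr //.
rewrite normrM normfV (gtr0_norm S0) ger0_norm ?powR_ge0 //.
rewrite mulrC ler_pdivrMr // mul1r (bigD1 i) //= lerDl.
by apply: sumr_ge0 => j _; exact: powR_ge0.
Qed.

Lemma ext_alpha_field_Omega alpha (u : 'rV[R]_N) i : lnOmega F I u ->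
  ext_alpha_field E F I alpha u i = alpha_field E F I alpha u i.
Proof.
move=> [r [r0 rF] <-]; rewrite /ext_alpha_field /alpha_field.
have -> : radii (map_mx (@ln R) r) = r.
  by apply/rowP => j; rewrite !mxE lnK // posrE.
congr (_ - (_ - _)).
apply: eq_bigr => j _; apply: eq_bigr => k /andP[_ /rF[ij jk ik]].
rewrite /gen_theta /gen_inner_angle asboolT //.
by split => //; rewrite addrC.
Qed.

End ExtendedField.

Unset Implicit Arguments.
Set Strict Implicit.
Set Printing Implicit Defensive.

(** * Long-time existence *)

Theorem theorem4p2 (R : realType) (M : topologicalType) (N : nat)
    (E F : {set {set 'I_N}}) (I : {set 'I_N} -> R) (alpha : R)
    (u0 : 'rV[R]_N) :
  closed_surface R M ->
  triangulates R M E F ->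
  inversive_distance E I ->
  lnOmega F I u0 ->
  (forall (T : \bar R) (u : R -> 'rV[R]_N),
     (0 < T)%E ->
     maximal_solution (lnOmega F I) (alpha_field E F I alpha) T u ->
     u 0 = u0 ->
     (T < +oo)%E ->
     exists v : R -> 'rV[R]_N,
       (forall t, time_dom T t -> v t = u t) /\
       solution [set: 'rV[R]_N]%classic (ext_alpha_field E F I alpha) +oo%E v) /\
  (exists v : R -> 'rV[R]_N,
     v 0 = u0 /\
     solution [set: 'rV[R]_N]%classic (ext_alpha_field E F I alpha) +oo%E v).
Proof.
move=> _ [EF _] I0 _.
have Xc i : continuous (fun u => ext_alpha_field E F I alpha u i).
  exact: ext_alpha_field_continuous EF I0 alpha i.
have XB u i := ext_alpha_field_bounded EF I0 alpha u i.
split; last exact: peano_global Xc XB u0.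
move=> [T| |] u //; rewrite lte_fin => T0 [usol _] _ _.
apply: (solution_extends Xc XB T0) => t /usol[uO du]; split=> // i.
by rewrite ext_alpha_field_Omega.
Qed.
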